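(* The following assertion (Leibman's conjecture) is false: ''Let $W=N/\Lambda$ be a connected nilmanifold with quotient map $\pi:N\to W$, and let $Y=\pi(H)$ be a connected subnilmanifold of $W$, where $H$ is a connected closed subgroup of $N$. Let $g:\mathbb Z\to N$ be a polynomial sequence with $g(0)=\mathrm{Id}_N$ such that $g(\mathbb Z)Y$ is dense in $W$, and assume that $N$ is generated by its identity component $N^o$ and the elements of $g$. Let $Z$ be the normal closure of $Y$ in $W$. Then for every $f\in C(W)$, $$\lim_{n\to\infty}\left(\int_{g(n)Y} f\,d\mu_{g(n)Y}-\int_{g(n)Z} f\,d\mu_{g(n)Z}\right)=0.''$$ That is, there exist $N,\Lambda,H,g$ satisfying all these hypotheses (with $Y$ and $Z$ the corresponding subnilmanifolds) and a function $f\in C(W)$ for which the displayed limit statement fails.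
   Context: A nilmanifold is a compact space $W=N/\Lambda$ with $N$ a nilpotent Lie group and $\Lambda$ a discrete co-compact subgroup. A subnilmanifold is a closed subset of $W$ of the form $\pi(L)$ (or a translate of such a set), with $L$ a closed subgroup of $N$; it carries a Haar measure $\mu_{\pi(L)}$, the unique $L$-invariant Borel probability measure on $\pi(L)$. For $g\in N$, $\mu_{g\pi(L)}$ is the push-forward of $\mu_{\pi(L)}$ under translation by $g$. The normal closure of $Y=\pi(H)$ in $W$ is the subnilmanifold $Z=\pi(\langle\langle H\rangle\rangle^N)$, where $\langle\langle H\rangle\rangle^N$ is the smallest normal subgroup of $N$ containing $H$. A polynomial sequence in $N$ is a map $g(n)=a_1^{p_1(n)}\cdots a_r^{p_r(n)}$ with $a_i\in N$ and $p_i$ polynomials mapping $\mathbb Z$ to $\mathbb Z$. $C(W)$ is the space of continuous complex-valued functions on $W$. *)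

(* Defs.v *)
From HB Require Import structures.
From mathcomp Require Import all_boot all_order all_algebra.
From mathcomp Require Import complex.
From mathcomp Require Import all_classical all_reals all_analysis.

Set Implicit Arguments.
Unset Strict Implicit.
Unset Printing Implicit Defensive.

Import Order.TTheory GRing.Theory Num.Theory.
Import numFieldNormedType.Exports.

Local Open Scope classical_set_scope.
Local Open Scope ring_scope.
Local Open Scope quotient_scope.

Definition is_subgroup (N : groupType) (S : set N) : Prop :=
  S 1%g /\ forall x y, S x -> S y -> S (x * y^-1)%g.

Record subgroup (N : groupType) := Subgroup {
  subgroup_set :> set N;
  subgroupP : is_subgroup subgroup_set }.

Definition is_normal_subgroup (N : groupType) (S : set N) : Prop :=
  is_subgroup S /\ forall x y, S x -> S (x ^ y)%g.

Definition generated (N : groupType) (A : set N) : set N :=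
  smallest (@is_subgroup N) A.

Lemma normal_closure_subproof (N : groupType) (A : set N) :
  is_subgroup (smallest (@is_normal_subgroup N) A).
Proof.
split=> [B [[[B1 _] _] _] //|x y Sx Sy B BA].
by have [[[_ BV] _] _] := BA; apply: BV; [exact: Sx|exact: Sy].
Qed.

Definition normal_closure (N : groupType) (A : set N) : subgroup N :=
  Subgroup (normal_closure_subproof A).

Fixpoint lower_central (N : groupType) (k : nat) : set N :=
  if k is k'.+1 then
    generated [set [~ x, y]%g | x in lower_central k' & y in [set: N]]
  else [set: N].

Arguments lower_central : clear implicits.

Definition nilpotent_group (N : groupType) : Prop :=
  exists k, lower_central N k = [set 1%g].

Definition expgz (N : groupType) (x : N) (n : int) : N :=
  match n with Posz k => x ^+ k | Negz k => x ^- k.+1 end%g.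

(* g(n) = a_1^{p_1(n)} ... a_r^{p_r(n)}, each q_i : Z -> Z being the restriction
   to Z of a polynomial p_i; a polynomial mapping Z to Z has rational, not
   necessarily integral, coefficients. *)
Definition polynomial_sequence (N : groupType) (g : int -> N) : Prop :=
  exists (r : nat) (a : 'I_r -> N) (p : 'I_r -> {poly rat})
         (q : 'I_r -> int -> int),
    (forall i n, (p i).[n%:~R] = (q i n)%:~R) /\
    (forall n, g n = (\prod_(i < r) expgz (a i) (q i n))%g).

(* For U open and V finite-dimensional, f is C^{k+1} on U iff it is Frechet
   differentiable on U with all directional derivatives C^k on U. *)
Fixpoint Ck_on (R : realType) (V W : normedModType R) (k : nat)
    (U : set V) (f : V -> W) : Prop :=
  if k is k'.+1 then
    (forall x, U x -> differentiable f x) /\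
    (forall v : V, Ck_on k' U ('D_v f))
  else forall x, U x -> {for x, continuous f}.

Definition smooth_on (R : realType) (V W : normedModType R)
    (U : set V) (f : V -> W) : Prop := forall k, Ck_on k U f.

(* Homeomorphism from the open set chart_dom onto an open subset of R^d; the
   values of chart_fun outside chart_dom, and those of chart_inv outside
   chart_cod, are irrelevant. *)
Record chart (R : realType) (d : nat) (M : topologicalType) := Chart {
  chart_dom : set M;
  chart_fun : M -> 'rV[R]_d;
  chart_inv : 'rV[R]_d -> M;
  chart_dom_open : open chart_dom;
  chart_cod_open : open (chart_fun @` chart_dom);
  chart_funK : forall x, chart_dom x -> chart_inv (chart_fun x) = x;
  chart_fun_continuous : {within chart_dom, continuous chart_fun};
  chart_inv_continuous :
    {within chart_fun @` chart_dom, continuous chart_inv} }.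

Definition chart_cod (R : realType) (d : nat) (M : topologicalType)
  (c : chart R d M) : set 'rV[R]_d := chart_fun c @` chart_dom c.

Definition smooth_atlas (R : realType) (d : nat) (M : topologicalType)
    (A : set (chart R d M)) : Prop :=
  (forall x : M, exists2 c, A c & chart_dom c x) /\
  (forall c c', A c -> A c' ->
     smooth_on (chart_fun c @` (chart_dom c `&` chart_dom c'))
               (chart_fun c' \o chart_inv c)).

HB.mixin Record isTopologicalGroup G of Group G & Topological G := {
  mulg_continuous : continuous (fun z : G * G => (z.1 * z.2)%g);
  invg_continuous : continuous (fun x : G => (x^-1)%g) }.

#[short(type="topologicalGroupType")]
HB.structure Definition TopologicalGroup :=
  {G of Group G & Topological G & isTopologicalGroup G}.

HB.mixin Record isLieGroup (R : realType) G of TopologicalGroup G := {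
  lie_dim : nat;
  lie_atlas : set (chart R lie_dim G);
  lie_hausdorff : hausdorff_space G;
  lie_second_countable : @second_countable G;
  lie_atlas_smooth : smooth_atlas lie_atlas;
  lie_mulg_smooth : forall a b c : chart R lie_dim G,
    lie_atlas a -> lie_atlas b -> lie_atlas c ->
    smooth_on
      [set z : 'rV[R]_lie_dim * 'rV[R]_lie_dim |
        [/\ chart_cod a z.1, chart_cod b z.2 &
            chart_dom c (chart_inv a z.1 * chart_inv b z.2)%g]]
      (fun z => chart_fun c (chart_inv a z.1 * chart_inv b z.2)%g);
  lie_invg_smooth : forall a c : chart R lie_dim G,
    lie_atlas a -> lie_atlas c ->
    smooth_on
      [set z | chart_cod a z /\ chart_dom c ((chart_inv a z)^-1)%g]
      (fun z => chart_fun c ((chart_inv a z)^-1)%g) }.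

#[short(type="lieGroupType")]
HB.structure Definition LieGroup (R : realType) :=
  {G of TopologicalGroup G & isLieGroup R G}.

Definition identity_component (N : topologicalGroupType) : set N :=
  connected_component [set: N] 1%g.

Arguments identity_component : clear implicits.

Section coset_space.
Variables (N : topologicalGroupType) (L : subgroup N).

Definition coset_rel : rel N := fun x y => `[< subgroup_set L (x^-1 * y)%g >].

Lemma coset_rel_equiv : equiv_class_of coset_rel.
Proof.
have [L1 LV] := subgroupP L.
have LI x : subgroup_set L x -> subgroup_set L (x^-1)%g by move=> Lx; rewrite -[(x^-1)%g]mul1g; exact: LV.
split.
- by move=> x; apply/asboolP; rewrite mulVg.
- move=> x y; apply/asboolP/asboolP => /LI; rewrite invgM invgK//.
- move=> y x z /asboolP xy /asboolP yz; apply/asboolP.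
  have := LV _ _ xy (LI _ yz).
  by rewrite invgK mulgA -[(x^-1 * y * y^-1)%g]mulgA mulgV mulg1.
Qed.

Canonical coset_equiv := EquivRelPack coset_rel_equiv.

Definition coset_space : Type := quotient_topology {eq_quot coset_equiv}.

HB.instance Definition _ := Quotient.on coset_space.
HB.instance Definition _ := Topological.on coset_space.

Definition coset_proj (x : N) : coset_space := \pi_coset_space x.

HB.instance Definition _ := isPointed.Build coset_space (coset_proj 1%g).

(* The action of g on N / L by left translation; it does not depend on the
   choice of representatives, see translation_proj. *)
Definition translation (g : N) (w : coset_space) : coset_space :=
  coset_proj (g * repr w)%g.

End coset_space.

Notation borel T := (g_sigma_algebraType (@open T)).

Section translation.
Variables (N : topologicalGroupType) (L : subgroup N) (g : N).

Lemma translation_proj x :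
  translation g (coset_proj L x) = coset_proj L (g * x)%g.
Proof.
rewrite /translation /coset_proj; apply/eqmodP/asboolP.
rewrite invgM -mulgA [(g^-1 * _)%g]mulgA mulVg mul1g.
apply/asboolP; change (coset_equiv L (repr (\pi_(coset_space L) x)) x).
by apply/eqmodP; rewrite reprK.
Qed.

Lemma translation_continuous : continuous (@translation N L g).
Proof.
apply/quotient_continuous.
have -> : translation g \o \pi_(coset_space L) =
          coset_proj L \o (fun x => g * x)%g.
  by apply/funext => x; exact: translation_proj.
move=> x; apply: continuous_comp; last exact: pi_continuous.
apply: (@continuous_comp _ _ _ (fun x : N => (g, x))
          (fun z : N * N => (z.1 * z.2)%g)); last exact: mulg_continuous.
by apply: cvg_pair; [exact: cvg_cst|exact: cvg_id].
Qed.

Lemma translation_measurable :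
  measurable_fun [set: borel (coset_space L)]
    (translation g : borel (coset_space L) -> borel (coset_space L)).
Proof.
apply: (@measurability _ _ (borel (coset_space L)) (borel (coset_space L)) _
          (translation g) (@open (coset_space L)) erefl).
move=> _ [A oA <-]; rewrite setTI; apply: sub_sigma_algebra.
by move/continuousP: translation_continuous; exact.
Qed.

HB.instance Definition _ :=
  isMeasurableFun.Build _ _ (borel (coset_space L)) (borel (coset_space L))
    (translation g : borel (coset_space L) -> borel (coset_space L))
    translation_measurable.

End translation.

Section nilmanifold.
Variables (R : realType) (N : lieGroupType R) (L : subgroup N).

Definition discrete_subgroup : Prop := L `<=` isolated L.

Definition nilmanifold : Prop :=
  [/\ nilpotent_group N, discrete_subgroup & compact [set: coset_space L]].

Definition subnilmanifold (K : subgroup N) : Prop :=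
  closed (K : set N) /\ closed (coset_proj L @` K).

(* The K-invariant Borel probability measure on the closed set pi(K), regarded
   as a measure on N / L carried by pi(K); it is unique because K acts
   transitively on pi(K) by left translation. *)
Definition haar_measure (K : subgroup N)
    (mu : probability (borel (coset_space L)) R) : Prop :=
  mu (coset_proj L @` K) = 1%E /\
  forall k (A : set (borel (coset_space L))), subgroup_set K k -> measurable A ->
    mu (translation k @^-1` A) = mu A.

Definition complex_integral (mu : probability (borel (coset_space L)) R)
    (D : set (borel (coset_space L))) (f : coset_space L -> R[i]) : R[i] :=
  Complex (\int[mu]_(x in D) complex.Re (f x))
          (\int[mu]_(x in D) complex.Im (f x)).

(* The integral of f over g D against the push-forward of mu under translation
   by g: distribution mu h is the library's push-forward of the probability mu
   along the measurable map h. *)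
Definition translate_integral (mu : probability (borel (coset_space L)) R)
    (g : N) (D : set (coset_space L)) (f : coset_space L -> R[i]) : R[i] :=
  complex_integral (distribution mu (translation g)) (translation g @` D) f.

End nilmanifold.

(* Main.v *)
Require Import Defs.
From HB Require Import structures.
From mathcomp Require Import all_boot all_order all_algebra.
From mathcomp Require Import complex.
From mathcomp Require Import all_classical all_reals all_analysis.
From mathcomp Require Import measurable_realfun.
From mathcomp Require Import ring lra zify.

(** The counterexample is N = Z^2 \ltimes R^3, where (b, c) acts on R^3 by the
    unipotent matrix 1 + b E + c E^2, E being the nilpotent shift
    (x, y, z) |-> (0, x, y), and Lambda = Z^2 \ltimes Z^3, so that W is the torus
    R^3 / Z^3.  The orbit of the line H = R (1, 0, 0) under Z^2 spans R^3, hence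
    Z = W.  The coefficients b and c of the action are linearly independent, but
    along the polynomial sequence g(n) = (0, 0, n sqrt 2) . (n, 0) the second one
    vanishes identically: g(n) Y is the set of all (t, n t, n sqrt 2).  These
    circles fill W because n sqrt 2 is dense modulo 1 while n grows, but each of
    them lies at a constant height z, so the integral of cos (2 pi z) over
    g(n) Y is cos (2 pi n sqrt 2), which does not tend to 0, whereas its integral
    over g(n) Z = W is 0. *)

Set Implicit Arguments.
Unset Strict Implicit.
Unset Printing Implicit Defensive.

Import Order.TTheory GRing.Theory Num.Theory.
Import numFieldNormedType.Exports.

Local Open Scope classical_set_scope.
Local Open Scope ring_scope.

(** * Smoothness of constant and linear maps *)

Section smooth.
Variables (R : realType) (V W : normedModType R).

Lemma smooth_on_cst (U : set V) (w : W) : smooth_on U (fun=> w).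
Proof.
move=> k; elim: k w => [|k IH] w /=; first by move=> x _; exact: cst_continuous.
split=> [x _|v]; first exact: differentiable_cst.
have -> : 'D_v (fun=> w : W) = (fun=> 0 : W).
  by apply/funext => x; exact: derive_cst.
exact: IH.
Qed.

(** The derivative along [v] is the constant [f v], so everything beyond the first derivative is the
    constant case. In the charts chosen below, transition maps, product and inverse are all linear,
    so this settles every smoothness condition. *)
Lemma smooth_on_linear (U : set V) (f : {linear V -> W}) :
  continuous f -> smooth_on U f.
Proof.
move=> cf [|k] /=; first by move=> x _; exact: cf.
split=> [x _|v]; first exact: linear_differentiable.
have -> : 'D_v f = (fun=> f v).
  apply/funext => x; rewrite deriveE; last exact: linear_differentiable.
  by rewrite diff_lin.
exact: smooth_on_cst.
Qed.

End smooth.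

(** * Rows of length three, entrywise continuity and Hausdorff products *)

Section row3.
Variable T : Type.

Definition row3 (x y z : T) : 'rV[T]_3 := \row_j tnth [tuple x; y; z] j.

Definition i0 : 'I_3 := ord0.
Definition i1 : 'I_3 := lift ord0 ord0.
Definition i2 : 'I_3 := ord_max.

Lemma row30 x y z : row3 x y z 0 i0 = x. Proof. by rewrite mxE. Qed.
Lemma row31 x y z : row3 x y z 0 i1 = y. Proof. by rewrite mxE. Qed.
Lemma row32 x y z : row3 x y z 0 i2 = z. Proof. by rewrite mxE. Qed.

Lemma ord3_ind (P : 'I_3 -> Prop) : P i0 -> P i1 -> P i2 -> forall j, P j.
Proof.
move=> P0 P1 P2 [[|[|[|//]]] ji].
- by rewrite (_ : Ordinal _ = i0)//; exact: val_inj.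
- by rewrite (_ : Ordinal _ = i1)//; exact: val_inj.
- by rewrite (_ : Ordinal _ = i2)//; exact: val_inj.
Qed.

Lemma row3P (u v : 'rV[T]_3) :
  u 0 i0 = v 0 i0 -> u 0 i1 = v 0 i1 -> u 0 i2 = v 0 i2 -> u = v.
Proof. by move=> ? ? ?; apply/rowP; apply: ord3_ind. Qed.

End row3.

Definition row3E := (row30, row31, row32).

Lemma mx_continuous (S T : topologicalType) m n (F : S -> 'M[T]_(m, n)) :
  (forall i j, continuous (fun x => F x i j)) -> continuous F.
Proof.
move=> cF x A [P PF PA].
have : \forall y \near x, forall i j, P i j (F y i j).
  by do 2![apply: filter_forall => ?]; exact: cF.
by apply: filterS => y Py; exact: PA.
Qed.

Lemma row3_continuous (S T : topologicalType) (f g h : S -> T) :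
  continuous f -> continuous g -> continuous h ->
  continuous (fun x => row3 (f x) (g x) (h x)).
Proof.
move=> cf cg ch; apply: mx_continuous => i; rewrite ord1.
by apply: ord3_ind; [under eq_fun do rewrite row30|
  under eq_fun do rewrite row31|under eq_fun do rewrite row32].
Qed.

Lemma cluster_continuous (S T : topologicalType) (f : S -> T) (p q : S) :
  continuous f -> cluster (nbhs p) q -> cluster (nbhs (f p)) (f q).
Proof.
move=> cf pq A B /cf fA /cf fB; have [x [Ax Bx]] := pq _ _ fA fB.
by exists (f x).
Qed.

(** [hausdorff_space] says that [nbhs p] clusters only at [p], and the two projections, being
    continuous, carry cluster points to cluster points. *)
Lemma hausdorff_prod (S T : topologicalType) :
  hausdorff_space S -> hausdorff_space T -> hausdorff_space (S * T)%type.
Proof.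
move=> hS hT [p1 p2] [q1 q2] pq; congr pair.
- by apply: hS; apply: (cluster_continuous (f := fst)) pq => ?; exact: cvg_fst.
- by apply: hT; apply: (cluster_continuous (f := snd)) pq => ?; exact: cvg_snd.
Qed.

(** * A countable base of R^n *)

Section rational_boxes.
Variables (R : realType) (n : nat).

Definition rational_box (s : {ffun 'I_n -> rat * rat}) : set 'rV[R]_n :=
  [set v | forall j, `]ratr (s j).1, ratr (s j).2[%classic (v 0 j)].

Lemma rational_box_open s : open (rational_box s).
Proof.
rewrite openE => v vs; rewrite /interior.
apply: (@filter_forall _ _ (fun j (w : 'rV[R]_n) =>
  `]ratr (s j).1, ratr (s j).2[%classic (w 0 j)) (nbhs v)) => j.
apply: (@coord_continuous _ _ _ 0 j).
by apply: open_nbhs_nbhs; split; [exact: interval_open|exact: vs].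
Qed.

(** Rational endpoints are picked on either side of each coordinate, within the radius of a ball.
    The boxes serve twice: for second countability of the group and for measurability of maps into
    the torus. *)
Lemma rational_box_nbhs (v : 'rV[R]_n) (A : set 'rV[R]_n) : nbhs v A ->
  exists s, rational_box s v /\ rational_box s `<=` A.
Proof.
move=> /nbhs_ballP[e /= e0 eA].
have rats j : exists pq : rat * rat,
    v 0 j - e < ratr pq.1 < v 0 j /\ v 0 j < ratr pq.2 < v 0 j + e.
  have /rat_in_itvoo[p] : v 0 j - e < v 0 j by rewrite ltrBlDr ltrDl.
  have /rat_in_itvoo[q] : v 0 j < v 0 j + e by rewrite ltrDl.
  by rewrite !in_itv/= => hq hp; exists (p, q).
have [s hs] := choice rats.
exists (finfun s); split=> [j|w ws].
  have [/andP[_ ?] /andP[? _]] := hs j.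
  by rewrite ffunE/= in_itv/=; apply/andP.
apply: eA; split=> // i j; rewrite ord1.
have [/andP[? _] /andP[_ ?]] := hs j.
have := ws j; rewrite ffunE/= in_itv/= => /andP[? ?].
by rewrite /ball/= ltr_norml; apply/andP; split; lra.
Qed.

End rational_boxes.

(** * The Lie group *)

(* Z^2 with (b, c) standing for the matrix 1 + b E + c E^2, which dictates the
   law mul2 below. *)
Definition nilZ2 := discrete_topology (int * int)%type.
Section nilN.
Variable R : realType.

Definition nilN : Type := (nilZ2 * 'rV[R]_3)%type.
HB.instance Definition _ := Choice.on nilN.
HB.instance Definition _ := Topological.on nilN.

Definition act (m : nilZ2) (v : 'rV[R]_3) : 'rV[R]_3 :=
  row3 (v 0 i0) (v 0 i1 + m.1%:~R * v 0 i0)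
    (v 0 i2 + m.1%:~R * v 0 i1 + m.2%:~R * v 0 i0).

Definition mul2 (m n : nilZ2) : nilZ2 := (m.1 + n.1, m.2 + n.2 + m.1 * n.1).
(** Since E^3 = 0, the inverse of 1 + b E + c E^2 is 1 - b E + (b^2 - c) E^2. *)
Definition inv2 (m : nilZ2) : nilZ2 := (- m.1, m.1 ^+ 2 - m.2).

Lemma act_is_linear m : linear (act m).
Proof. by move=> a u v; apply: row3P; rewrite !(row3E, mxE); ring. Qed.
HB.instance Definition _ m := GRing.isLinear.Build R 'rV[R]_3 'rV[R]_3 _ (act m)
  (act_is_linear m).

Lemma act1 v : act (0, 0) v = v.
Proof. by apply: row3P; rewrite !row3E /=; ring. Qed.

Lemma actM m n v : act (mul2 m n) v = act m (act n v).
Proof. by apply: row3P; rewrite !row3E /= ?intrD ?intrM; ring. Qed.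

Lemma act0 m : act m 0 = 0. Proof. exact: linear0. Qed.
Lemma actD m u v : act m (u + v) = act m u + act m v.
Proof. exact: linearD. Qed.
Lemma actN m v : act m (- v) = - act m v. Proof. exact: linearN. Qed.

Definition nil_mul (x y : nilN) : nilN := (mul2 x.1 y.1, x.2 + act x.1 y.2).
Definition nil_one : nilN := ((0, 0), 0).
Definition nil_inv (x : nilN) : nilN := (inv2 x.1, - act (inv2 x.1) x.2).

Lemma mul2A : associative mul2.
Proof. by move=> x y z; congr pair => /=; ring. Qed.
Lemma mul2_1 : left_id (0, 0) mul2.
Proof. by case=> b c; rewrite /mul2/= !add0r mul0r addr0. Qed.
Lemma mul2C : commutative mul2.
Proof. by move=> x y; congr pair => /=; ring. Qed.
Lemma mul2V x : mul2 (inv2 x) x = (0, 0).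
Proof. by congr pair => /=; ring. Qed.
Lemma mul2Vr x : mul2 x (inv2 x) = (0, 0).
Proof. by congr pair => /=; ring. Qed.

Lemma nil_mulA : associative nil_mul.
Proof. by move=> x y z; rewrite /nil_mul/= mul2A actM actD addrA. Qed.
Lemma nil_mul1 : left_id nil_one nil_mul.
Proof.
by case=> m v; rewrite /nil_mul/= act1 add0r mul2_1.
Qed.
Lemma nil_mulr1 : right_id nil_one nil_mul.
Proof.
by case=> m v; rewrite /nil_mul/= act0 addr0 mul2C mul2_1.
Qed.
Lemma nil_mulV : left_inverse nil_one nil_inv nil_mul.
Proof. by move=> x; rewrite /nil_mul/= mul2V addrC subrr. Qed.
Lemma nil_mulVr : right_inverse nil_one nil_inv nil_mul.
Proof. by move=> x; rewrite /nil_mul/= mul2Vr actN -actM mul2Vr act1 subrr. Qed.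

HB.instance Definition _ := isGroup.Build nilN nil_mulA
  nil_mul1 nil_mulr1 nil_mulV nil_mulVr.

Lemma act_continuous m : continuous (act m).
Proof.
have c j : continuous (fun v : 'rV[R]_3 => v 0 j) by exact: coord_continuous.
have d (a : R) j (v : 'rV[R]_3) : a * (w : 'rV[R]_3) 0 j @[w --> v] --> a * v 0 j.
  exact: (cvgMl_tmp (c j v)).
apply: row3_continuous => [|v|v]; first exact: c.
- exact: (cvgD (c i1 v) (d _ i0 v)).
- exact: (cvgD (cvgD (c i2 v) (d _ i1 v)) (d _ i0 v)).
Qed.

(** The first factor is discrete. Continuity on [nilN] thus reduces to the vector component, with
    the matrix held fixed. *)
Lemma nilN_nbhs_fst (x : nilN) : \forall y \near x, y.1 = x.1.
Proof.
exists ([set x.1], setT); first by split; [exact: discrete_set1|exact: filterT].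
by move=> y [].
Qed.

Lemma snd_nilN_continuous : continuous (snd : nilN -> 'rV[R]_3).
Proof. by move=> x; exact: cvg_snd. Qed.

Lemma pair_nilN_continuous (m : nilZ2) :
  continuous (fun v : 'rV[R]_3 => (m, v) : nilN).
Proof.
move=> v A [[B1 B2] [/= B1m B2v] BA].
by apply: filterS B2v => w Bw; apply: BA; split=> //=; exact: nbhs_singleton.
Qed.

Lemma nil_mul_continuous : continuous (fun z : nilN * nilN => (z.1 * z.2)%g).
Proof.
move=> z A.
change (nbhs (nil_mul z.1 z.2) A -> nbhs z [set w | A (nil_mul w.1 w.2)]).
move=> -[[B1 B2] [/= B1z B2z] BA].
have c1 : {for z, continuous (fun w : nilN * nilN => w.1.2)}.
  apply: (@continuous_comp _ _ _ fst snd); first exact: cvg_fst.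
  exact: snd_nilN_continuous.
(* The matrix is frozen at [z.1.1]; near [z] it coincides with [w.1.1]. *)
have c2 : {for z, continuous (fun w : nilN * nilN => act z.1.1 w.2.2)}.
  apply: (@continuous_comp _ _ _ snd (act z.1.1 \o snd)); first exact: cvg_snd.
  by apply: continuous_comp; [exact: snd_nilN_continuous|exact: act_continuous].
have : \forall w \near z, B2 (w.1.2 + act z.1.1 w.2.2) by exact: (cvgD c1 c2 B2z).
have : \forall w \near z, w.1.1 = z.1.1 /\ w.2.1 = z.2.1.
  apply: filterI.
    exact: (cvg_fst (nilN_nbhs_fst z.1)).
  exact: (cvg_snd (nilN_nbhs_fst z.2)).
apply: filterS2 => w [w1 w2] Bw; apply: BA; split=> /=.
  rewrite w1 w2; exact: nbhs_singleton.
by rewrite w1.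
Qed.

Lemma nil_inv_continuous : continuous (fun z : nilN => (z^-1)%g).
Proof.
move=> z A.
change (nbhs (nil_inv z) A -> nbhs z [set w | A (nil_inv w)]).
move=> -[[B1 B2] [/= B1z B2z] BA].
have : \forall w \near z, B2 (- act (inv2 z.1) w.2).
  have c : {for z, continuous (act (inv2 z.1) \o snd : nilN -> _)}.
    by apply: continuous_comp; [exact: snd_nilN_continuous|exact: act_continuous].
  exact: (cvgN c B2z).
apply: filterS2 (nilN_nbhs_fst z) => w w1 Bw; apply: BA; split=> /=.
  by rewrite w1; exact: nbhs_singleton.
by rewrite w1.
Qed.

HB.instance Definition _ :=
  isTopologicalGroup.Build nilN nil_mul_continuous nil_inv_continuous.

(** Each component {m} x R^3 is covered by one global chart onto R^3. *)
Program Definition nil_chart (m : nilZ2) : chart R 3 nilN :=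
  @Chart R 3 nilN [set x | x.1 = m] snd (pair m) _ _ _ _ _.
Next Obligation.
move=> m; rewrite openE => x /= xm; rewrite /interior.
by apply: filterS (nilN_nbhs_fst x) => y /= ->.
Qed.
Next Obligation.
move=> m; rewrite (_ : _ @` _ = setT); first exact: openT.
by apply/seteqP; split=> // v _; exists (m, v).
Qed.
Next Obligation. by move=> m [n v] /= ->. Qed.
Next Obligation.
by move=> m; apply: continuous_subspaceT; exact: snd_nilN_continuous.
Qed.
Next Obligation.
by move=> m; apply: continuous_subspaceT; exact: pair_nilN_continuous.
Qed.

Lemma nilN_hausdorff : hausdorff_space nilN.
Proof.
by apply: hausdorff_prod; [exact: discrete_hausdorff|exact: norm_hausdorff].
Qed.

Lemma nilN_second_countable : @second_countable nilN.
Proof.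
exists (range (fun ms : (int * int) * {ffun 'I_3 -> rat * rat} =>
    [set ms.1] `*` rational_box ms.2 : set nilN)).
  by apply: sub_countable (card_image_le _ _) _; exact: countableP.
split=> [_ [[m s] _ <-]|x].
  rewrite openE => -[k v] [/= -> sv]; exists ([set m], rational_box s) => //=.
  split; first exact: discrete_set1.
  by apply: open_nbhs_nbhs; split=> //; exact: rational_box_open.
move=> A [[B1 B2] [/= B1x B2x] BA].
have [s [sx sB]] := rational_box_nbhs B2x.
exists ([set x.1] `*` rational_box s) => //.
  by split=> //; exists (x.1, s).
move=> y [/= y1 y2]; apply: BA; split=> /=.
  by rewrite y1; exact: nbhs_singleton.
exact: sB.
Qed.

Lemma nilN_atlas_smooth : smooth_atlas (range nil_chart).
Proof.
split=> [x|_ _ [m _ <-] [n _ <-]]; first by exists (nil_chart x.1) => //; exists x.1.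
(* Composing [snd] with [pair m] gives the identity for all [m] and [n], also when the two chart
   domains are disjoint. *)
have -> : chart_fun (nil_chart n) \o chart_inv (nil_chart m) =
    (idfun : {linear 'rV[R]_3 -> 'rV[R]_3}).
  by [].
by apply: smooth_on_linear => x; exact: cvg_id.
Qed.

Let mulf (m : nilZ2) (z : 'rV[R]_3 * 'rV[R]_3) := z.1 + act m z.2.
Let mulf_linear m : linear (mulf m).
Proof. by move=> a u v; rewrite /mulf/= linearP scalerDr addrACA. Qed.
HB.instance Definition _ m := GRing.isLinear.Build R _ _ _ (mulf m)
  (mulf_linear m).

(** With the left factor in the component of [m], the product reads (u, v) |-> u + [act m v], which
    is linear in the pair; the matrix of the right factor does not enter the vector part. *)
Lemma nilN_mulg_smooth (a b c : chart R 3 nilN) :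
  range nil_chart a -> range nil_chart b -> range nil_chart c ->
    smooth_on
      [set z : 'rV[R]_3 * 'rV[R]_3 |
        [/\ chart_cod a z.1, chart_cod b z.2 &
            chart_dom c (chart_inv a z.1 * chart_inv b z.2)%g]]
      (fun z => chart_fun c (chart_inv a z.1 * chart_inv b z.2)%g).
Proof.
move=> [m _ <-] [n _ <-] [k _ <-].
apply: (@smooth_on_linear _ _ _ _ (mulf m)) => z.
apply: cvgD; first exact: cvg_fst.
by apply: (@cvg_comp _ _ _ snd (act m)); [exact: cvg_snd|exact: act_continuous].
Qed.

Lemma nilN_invg_smooth (a c : chart R 3 nilN) :
  range nil_chart a -> range nil_chart c ->
    smooth_on
      [set z | chart_cod a z /\ chart_dom c ((chart_inv a z)^-1)%g]
      (fun z => chart_fun c ((chart_inv a z)^-1)%g).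
Proof.
move=> [m _ <-] [k _ <-].
apply: (@smooth_on_linear _ _ _ _ (-%R \o act (inv2 m))) => z.
exact: (cvgN (@act_continuous (inv2 m) z)).
Qed.

HB.instance Definition _ := isLieGroup.Build R nilN nilN_hausdorff
  nilN_second_countable nilN_atlas_smooth nilN_mulg_smooth nilN_invg_smooth.

End nilN.

(** * Subgroups, nilpotency, normal closure *)

Section subgroups.
Variable R : realType.
Local Notation N := (nilN R).
Local Notation V := 'rV[R]_3.

Lemma nilN_mulE (x y : N) : (x * y)%g = nil_mul x y. Proof. by []. Qed.
Lemma nilN_invE (x : N) : (x^-1)%g = nil_inv x. Proof. by []. Qed.

Definition vec (v : V) : N := ((0, 0), v).

Lemma inv2_0 : inv2 (0, 0) = (0, 0). Proof. by congr pair => /=; ring. Qed.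

Lemma vecD u v : vec (u + v) = (vec u * vec v)%g.
Proof. by rewrite nilN_mulE /nil_mul/= act1; congr pair. Qed.

Lemma vecN u : vec (- u) = ((vec u)^-1)%g.
Proof. by rewrite nilN_invE /nil_inv/= inv2_0 act1. Qed.

Definition vec_set (P : set V) : set N := [set x | x.1 = (0, 0) /\ P x.2].

Lemma vec_set_subgroup (P : set V) : P 0 ->
  (forall u v, P u -> P v -> P (u - v)) -> is_subgroup (vec_set P).
Proof.
move=> P0 PB; split=> // -[m u] [n v] [/= -> Pu] [/= -> Pv].
by rewrite -[(_, v)]/(vec v) -vecN -vecD; split=> //=; exact: PB.
Qed.

Definition axis_set : set V := [set v | v 0 i1 = 0 /\ v 0 i2 = 0].

Lemma axis_subgroup : is_subgroup (vec_set axis_set).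
Proof.
apply: vec_set_subgroup => [|u v [u1 u2] [v1 v2]]; first by split; rewrite mxE.
by split; rewrite !mxE ?u1 ?u2 ?v1 ?v2 subrr.
Qed.

Definition subH : subgroup N := Subgroup axis_subgroup.

Definition int_set : set V := [set v | forall j, v 0 j \is a Num.int].

Lemma act_int m v : int_set v -> int_set (act m v).
Proof.
move=> Zv; apply: ord3_ind; rewrite !row3E ?Zv//.
  by rewrite rpredD ?rpredM ?intr_int// Zv.
by rewrite !rpredD ?rpredM ?intr_int// Zv.
Qed.

Lemma Lambda_subgroup : is_subgroup [set x : N | int_set x.2].
Proof.
split=> [j|[m u] [n v] /= Zu Zv]; first by rewrite mxE rpred0.
rewrite actN -actM => j.
by rewrite mxE [X in _ + X]mxE rpredB ?Zu//; exact: act_int.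
Qed.

Definition Lambda : subgroup N := Subgroup Lambda_subgroup.

Lemma row3_basis (v : V) :
  v = row3 (v 0 i0) 0 0 + row3 0 (v 0 i1) 0 + row3 0 0 (v 0 i2).
Proof. by apply: row3P; rewrite !(row3E, mxE) /=; rewrite ?addr0 ?add0r. Qed.

(** Since x ^ y is y^-1 x y, conjugating by the inverse of (m, 0) is what produces [act m]
    itself. *)
Lemma conj_vec (m : nilZ2) (v : V) :
  ((vec v) ^ (((m, 0) : N)^-1))%g = vec (act m v).
Proof.
rewrite /conjg invgK; have -> : (vec v * ((m, 0) : N)^-1)%g = (inv2 m, v).
  rewrite nilN_mulE nilN_invE /nil_mul/nil_inv/= act0 oppr0 act0 addr0.
  by rewrite mul2_1.
by rewrite nilN_mulE /nil_mul/= mul2Vr add0r.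
Qed.

(** The vector group is the kernel of the projection to an abelian group, hence normal. Conversely,
    conjugates of the first axis differ from it by its images under E and E^2, which are the other
    two axes. *)
Lemma normal_closure_subH : normal_closure subH = vec_set setT :> set N.
Proof.
apply/seteqP; split.
  apply: smallest_sub; last by move=> x [].
  split; first by apply: vec_set_subgroup.
  move=> [m u] [n v] [/= -> _]; split=> //.
  rewrite /conjg !nilN_mulE nilN_invE /nil_mul/nil_inv/=.
  by rewrite /mul2/inv2/=; congr pair; ring.
move=> [m v] [/= -> _] B [[[B1 BV] BJ] HB].
have BM x y : B x -> B y -> B (x * y)%g.
  move=> Bx By; rewrite -[y]invgK; apply: (BV) => //.
  by rewrite -[(y^-1)%g]mul1g; exact: BV.
have axis t : B (vec (row3 t 0 0)) by apply: HB; split=> //=; split; rewrite row3E.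
have axisJ k t : B (vec (act k (row3 t 0 0))) by rewrite -conj_vec; exact: BJ.
(* [act (0, 1)] is 1 + E^2 and [act (1, 0)], used next, is 1 + E; subtracting the identity sends the
   first axis to the third and to the second respectively. *)
have axis2 t : B (vec (row3 0 0 t)).
  suff -> : row3 0 0 t = act (0, 1) (row3 t 0 0) - row3 t 0 0.
    by rewrite vecD vecN; exact: BV.
  by apply: row3P; rewrite !(row3E, mxE) /=; ring.
have axis1 t : B (vec (row3 0 t 0)).
  suff -> : row3 0 t 0 = act (1, 0) (row3 t 0 0) - row3 t 0 0.
    by rewrite vecD vecN; exact: BV.
  by apply: row3P; rewrite !(row3E, mxE) /=; ring.
by rewrite -/(vec v) (row3_basis v) !vecD; apply: (BM) => //; exact: BM.
Qed.

(** Write [x, y] as (y x)^-1 (x y): both products have the same matrix because [mul2] is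
    commutative, so the commutator is a vector. With A and B the matrices of x and y, the difference
    is (A - 1) y.2 - (B - 1) x.2, where A - 1 and B - 1 are multiples of E. *)
Lemma nilN_commg (x y : N) :
  [~ x, y]%g = vec (act (inv2 (mul2 y.1 x.1))
                  ((x.2 + act x.1 y.2) - (y.2 + act y.1 x.2))).
Proof.
rewrite /commg/conjg mulgA -invgM !nilN_mulE nilN_invE /nil_mul/nil_inv/=.
rewrite addrC -actN -actD; congr pair.
by rewrite /mul2/inv2/=; congr pair; ring.
Qed.

(** Each commutator applies a multiple of E to vectors, which shifts the coordinates and annihilates
    one more of them; after three stages nothing is left. Stage 0 is the whole group. *)
Lemma nilN_nilpotent : nilpotent_group N.
Proof.
exists 3%N.
pose P1 : set V := [set v | v 0 i0 = 0].
pose P2 : set V := [set v | v 0 i0 = 0 /\ v 0 i1 = 0].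
have l1 : lower_central N 1 `<=` vec_set P1.
  apply: smallest_sub.
    apply: vec_set_subgroup => [|u v /= Pu Pv]; first by rewrite /P1/= mxE.
    by rewrite /P1/= !mxE Pu Pv subrr.
  move=> _ [x _ [y _ <-]]; rewrite nilN_commg; split=> //=.
  by rewrite /P1/= !(row3E, mxE); ring.
have l2 : lower_central N 2 `<=` vec_set P2.
  apply: smallest_sub.
    apply: vec_set_subgroup => [|u v /= [Pu Pu'] [Pv Pv']].
      by split; rewrite /= mxE.
    by split; rewrite !mxE ?Pu ?Pv ?Pu' ?Pv' subrr.
  move=> _ [x /l1 [x1 /= x2] [y _ <-]]; rewrite nilN_commg; split=> //=.
  by rewrite /P2/= !(row3E, mxE) x1 x2 /=; split; ring.
apply/seteqP; split; last first.
  by move=> _ -> B [[B1 _] _].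
have : lower_central N 3 `<=` vec_set [set 0].
  apply: smallest_sub.
    by apply: vec_set_subgroup => // u v /= -> ->; rewrite subrr.
  move=> _ [x /l2 [x1 /= [x2 x3]] [y _ <-]]; rewrite nilN_commg; split=> //=.
  by apply: row3P; rewrite !(row3E, mxE) ?x1 ?x2 ?x3 /=; ring.
by move=> l3 x /l3; case: x => m v [/= -> ->].
Qed.

(** R^n is the union of its lines through 0, each a continuous image of the real line. *)
Lemma rV_connected n : connected [set: 'rV[R]_n].
Proof.
have -> : [set: 'rV[R]_n] =
    \bigcup_(v in [set: 'rV[R]_n]) ((fun t : R => t *: v) @` setT).
  apply/seteqP; split=> // v _; exists v => //; exists 1 => //.
  by rewrite scale1r.
apply: bigcup_connected.
  by exists 0 => v _; exists 0 => //; rewrite scale0r.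
move=> v _; apply: connected_continuous_connected.
  by apply/connected_intervalP => x y _ _ z _.
by apply: continuous_subspaceT => t; exact: scalel_continuous.
Qed.

Lemma identity_component_vec (v : V) : identity_component N (vec v).
Proof.
apply: (@connected_component_max _ _ (vec @` setT)); last by exists v.
- by exists 0.
- by [].
apply: connected_continuous_connected; first exact: rV_connected.
by apply: continuous_subspaceT => u; exact: pair_nilN_continuous.
Qed.

Lemma axis_setE : axis_set = (fun t => row3 t 0 0) @` setT.
Proof.
apply/seteqP; split=> [v [v1 v2]|_ [t _ <-]]; last by split; rewrite row3E.
by exists (v 0 i0) => //; apply: row3P; rewrite !row3E.
Qed.

Lemma subH_connected : connected (subH : set N).
Proof.
have -> : (subH : set N) = (fun t => vec (row3 t 0 0)) @` setT.
  apply/seteqP; split=> [[m v] [/= -> ]|_ [t _ <-]].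
    by rewrite axis_setE => -[t _ <-]; exists t.
  by split=> //; rewrite axis_setE; exists t.
apply: connected_continuous_connected.
  by apply/connected_intervalP => x y _ _ z _.
apply: continuous_subspaceT => t.
apply: (@continuous_comp _ _ _ (fun t : R => row3 t 0 0) vec).
  by apply: row3_continuous => ?; [exact: cvg_id|exact: cvg_cst|exact: cvg_cst].
exact: pair_nilN_continuous.
Qed.

Lemma fst_closed (m : nilZ2) : closed [set x : N | x.1 = m].
Proof.
rewrite (_ : [set _ | _] = ~` [set x | x.1 != m]); last first.
  by apply/seteqP; split=> x /=;
    [move=> -> /negP|move=> /negP; rewrite negbK => /eqP].
apply: open_closedC; rewrite openE => x /= xm; rewrite /interior.
by apply: filterS (nilN_nbhs_fst x) => y /= ->.
Qed.

Lemma coord_eq0_closed j : closed [set v : V | v 0 j = 0].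
Proof.
have := @closed_comp _ _ (fun v : V => v 0 j) [set 0] _ (@closed_eq R 0).
by apply=> v _; exact: coord_continuous.
Qed.

Lemma snd_preimage_closed (A : set V) : closed A -> closed (snd @^-1` A : set N).
Proof.
move=> cA; apply: (@preimage_closed N V) => // x _.
exact: snd_nilN_continuous.
Qed.

Lemma subH_closed : closed (subH : set N).
Proof.
have -> : (subH : set N) = [set x | x.1 = (0, 0)] `&`
   (snd @^-1` [set v : V | v 0 i1 = 0] `&` snd @^-1` [set v : V | v 0 i2 = 0]).
  by [].
apply: closedI; first exact: fst_closed.
by apply: closedI; apply: snd_preimage_closed; exact: coord_eq0_closed.
Qed.

End subgroups.

(** * The torus N / Lambda and the sequence g *)

Section sqrt2.
Variable R : realType.
Local Notation s2 := (Num.sqrt 2 : R).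

Lemma sqrt2_sq : s2 * s2 = 2.
Proof. by rewrite -expr2 sqr_sqrtr. Qed.

Lemma sqrt2_bounds : 1 < s2 < 3 / 2.
Proof.
have := sqrt2_sq; have : 0 <= s2 := sqrtr_ge0 2.
by move=> h0 h; apply/andP; split; nra.
Qed.

(* The powers of sqrt 2 - 1 tend to 0: this gives the density of Z + Z sqrt 2
   without a pigeonhole argument. *)
Lemma sqrt2B1_exprE k : exists m n : int, (s2 - 1) ^+ k = m%:~R + n%:~R * s2.
Proof.
elim: k => [|k [m [n IH]]].
  by exists 1, 0; rewrite expr0 mul0r addr0.
exists (2 * n - m), (m - n); rewrite exprS IH !rmorphB/= rmorphM/=.
transitivity ((s2 * s2) * n%:~R + m%:~R * s2 - m%:~R - n%:~R * s2); first by ring.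
by rewrite sqrt2_sq; ring.
Qed.

(** A power d = m + n0 sqrt 2 of sqrt 2 - 1 lies in ]0, e[, so some multiple j d falls within e of z
    + L; then n = j n0 and c = L - j m. The bound |n| > M is what later makes the circle of slope n
    wind finely enough. *)
Lemma sqrt2_int_approx (z e : R) (M : nat) : 0 < e ->
  exists n c : int, M%:R < `|n%:~R| :> R /\ `|n%:~R * s2 - z - c%:~R| < e.
Proof.
move=> e0; have /andP[s1 s3] := sqrt2_bounds.
have t0 : 0 < s2 - 1 by lra.
have t1 : s2 - 1 < 1 by lra.
have [k [k0 ke]] : exists k, (0 < k)%N /\ (s2 - 1) ^+ k < e.
  have : (fun k => (s2 - 1) ^+ k) @ \oo --> (0 : R).
    by apply: cvg_expr; rewrite gtr0_norm.
  (* The exponent [k.+1] is positive, which gives d < 1 below. *)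
  move/cvgrPdist_lt => /(_ e e0) [k _ /(_ k.+1 (leqnSn _))] /=.
  by rewrite sub0r normrN gtr0_norm ?exprn_gt0// => ?; exists k.+1.
have [m [n0 dE]] := sqrt2B1_exprE k.
set d := (s2 - 1) ^+ k in ke dE.
have d0 : 0 < d by rewrite exprn_gt0.
have d1 : d < 1 by rewrite exprn_ilt1 ?ltW// -lt0n k0.
(* Otherwise d would be the integer m, strictly between 0 and 1. *)
have n00 : n0 != 0.
  apply/eqP => n00; move: d0 d1; rewrite dE n00 mul0r addr0.
  by rewrite -[1]/(1%:~R) ltr0z ltr_int; lia.
(* The integer shift L makes (z + L) / d exceed M + 1, hence j > M. *)
pose L := Num.floor (d * M.+1%:R - z) + 1.
pose j := Num.floor ((z + L%:~R) / d).
have Lz : d * M.+1%:R - z < L%:~R by rewrite /L floorD1_gt.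
have j1 : j%:~R * d <= z + L%:~R by rewrite -ler_pdivlMr// floor_le.
have j2 : z + L%:~R < (j + 1)%:~R * d by rewrite -ltr_pdivrMr// floorD1_gt.
have jM : (M.+1%:Z <= j).
  rewrite /j floor_ge_int -[_%:~R]/(M.+1%:R) ler_pdivlMr//; lra.
exists (j * n0), (L - j * m); split.
  rewrite intrM normrM -!intr_norm -intrM.
  rewrite -[M%:R]/((M%:Z)%:~R) ltr_int; move: jM n00; clear; nia.
have -> : (j * n0)%:~R * s2 - z - (L - j * m)%:~R = j%:~R * d - (z + L%:~R).
  by rewrite dE !(rmorphB, rmorphM)/=; ring.
clearbody L j; rewrite ltr_norml; move: j2; rewrite intrD => j2.
by apply/andP; split; lra.
Qed.

(** First n is chosen with n sqrt 2 near z modulo 1 and |n| > 1/e. Then t leaves x by at most 1/|n|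
    < e to make n t exactly congruent to y, so the second coordinate costs no error. *)
Lemma sqrt2_line_approx (x y z e : R) : 0 < e ->
  exists (n : int) (t : R) (b c : int), [/\ `|t - x| < e,
    `|n%:~R * t - y - b%:~R| < e & `|n%:~R * s2 - z - c%:~R| < e].
Proof.
move=> e0.
have [n [c [nM nc]]] := sqrt2_int_approx z (Num.truncn (e^-1)).+1 e0.
have n0 : (n%:~R : R) != 0.
  by apply: contraTneq nM => ->; rewrite normr0 -leNgt ler0n.
pose b := Num.floor (n%:~R * x - y).
exists n, ((y + b%:~R) / n%:~R), b, c; split=> //; last first.
  by have -> : n%:~R * ((y + b%:~R) / n%:~R) - y - b%:~R = 0 :> R;
    [field|rewrite normr0].
have -> : (y + b%:~R) / n%:~R - x = (b%:~R - (n%:~R * x - y)) / n%:~R by field.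
rewrite normrM normfV ltr_pdivrMr ?normr_gt0//.
have h1 : e^-1 < `|n%:~R| := lt_trans (truncnS_gt _) nM.
have : 1 < e * `|n%:~R| by rewrite mulrC -ltr_pdivrMr// mul1r.
have /andP[b1 b2] := floor_itv (n%:~R * x - y).
move=> h2; apply: (le_lt_trans _ h2); move: b1 b2; rewrite -/b intrD => b1 b2.
by rewrite ler_norml; apply/andP; split; lra.
Qed.
End sqrt2.

(** * The quotient as the torus R^3 / Z^3 *)

Section torus.
Variable R : realType.
Local Notation N := (nilN R).
Local Notation V := 'rV[R]_3.
Local Notation W := (coset_space (Lambda R)).

Definition torus_proj (v : V) : W := coset_proj (Lambda R) (vec v).

(** The vector part of x^-1 y is y.2 - x.2 moved by an integer matrix, which preserves integer
    vectors, and [Lambda] puts no condition on the matrix part. Cosets therefore depend only on the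
    vector part modulo Z^3. *)
Lemma coset_proj_eq (x y : N) :
  int_set (y.2 - x.2) -> coset_proj (Lambda R) x = coset_proj (Lambda R) y.
Proof.
move=> xy; apply/eqmodP/asboolP; change (int_set (nil_mul (nil_inv x) y).2).
by rewrite /nil_mul/nil_inv/= addrC -actN -actD; exact: act_int.
Qed.

Lemma coset_proj_int (x y : N) :
  coset_proj (Lambda R) x = coset_proj (Lambda R) y -> int_set (y.2 - x.2).
Proof.
move=> /eqmodP/asboolP xy.
have {}xy : int_set (nil_mul (nil_inv x) y).2 := xy.
move: xy; rewrite /nil_mul/nil_inv/= addrC -actN -actD => /(act_int x.1).
by rewrite -actM mul2Vr act1.
Qed.

Lemma int_set0 : int_set (0 : V).
Proof. by move=> j; rewrite mxE rpred0. Qed.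

Lemma coset_projE (x : N) : coset_proj (Lambda R) x = torus_proj x.2.
Proof. by apply: coset_proj_eq; rewrite subrr; exact: int_set0. Qed.

Lemma torus_proj_eq (u v : V) : int_set (v - u) -> torus_proj u = torus_proj v.
Proof. by move=> uv; apply: coset_proj_eq. Qed.

Lemma torus_proj_int (u v : V) : torus_proj u = torus_proj v -> int_set (v - u).
Proof. by move/coset_proj_int. Qed.

Lemma torus_proj_surj (w : W) : exists v, torus_proj v = w.
Proof. by exists (repr w).2; rewrite -coset_projE /coset_proj reprK. Qed.

Lemma torus_proj_continuous : continuous torus_proj.
Proof.
move=> v; apply: (@continuous_comp _ _ _ (@vec R) (coset_proj (Lambda R))).
  exact: pair_nilN_continuous.
exact: pi_continuous.
Qed.

Lemma translation_torus_proj (g : N) (v : V) :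
  translation g (torus_proj v) = torus_proj (g.2 + act g.1 v).
Proof. by rewrite /torus_proj translation_proj coset_projE. Qed.

(** W carries the quotient topology of N, and the preimage of A in N is the cylinder over its
    preimage in R^3. So [torus_proj] is itself a quotient map. *)
Lemma torus_proj_preimage_open (A : set W) : open (torus_proj @^-1` A) -> open A.
Proof.
move=> oA; change (open (coset_proj (Lambda R) @^-1` A)).
have -> : coset_proj (Lambda R) @^-1` A = snd @^-1` (torus_proj @^-1` A).
  by apply/seteqP; split=> x /=; rewrite coset_projE.
by apply: open_comp oA => x _; exact: snd_nilN_continuous.
Qed.

Lemma torus_proj_preimage_closed (A : set W) :
  closed (torus_proj @^-1` A) -> closed A.
Proof.
move=> /closed_openC cA; rewrite -[A]setCK; apply: open_closedC.
exact: torus_proj_preimage_open.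
Qed.

Lemma torus_compact : compact [set: W].
Proof.
have -> : [set: W] = torus_proj @` [set v : V | forall j, `[0, 1]%classic (v 0 j)].
  apply/seteqP; split=> // w _; have [v <-] := torus_proj_surj w.
  exists (\row_j (v 0 j - (Num.floor (v 0 j))%:~R)) => [j|].
    have /andP[h1 h2] := floor_itv (v 0 j); rewrite intrD in h2.
    by rewrite mxE /= in_itv/=; apply/andP; split; lra.
  by apply: torus_proj_eq => j; rewrite !mxE opprB addrC subrK intr_int.
apply: continuous_compact.
  by apply: continuous_subspaceT; exact: torus_proj_continuous.
by apply: (@rV_compact R 3 (fun=> `[0, 1]%classic)) => _; exact: segment_compact.
Qed.

Lemma torus_connected : connected [set: W].
Proof.
have -> : [set: W] = torus_proj @` setT.
  by apply/seteqP; split=> // w _; have [v <-] := torus_proj_surj w; exists v.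
apply: connected_continuous_connected; first exact: rV_connected.
by apply: continuous_subspaceT; exact: torus_proj_continuous.
Qed.

Lemma Lambda_discrete : discrete_subgroup (Lambda R).
Proof.
move=> x Lx; split; first exact/mem_set.
(* Two integer vectors whose coordinates differ by less than 1 coincide. *)
exists [set y : N | y.1 = x.1 /\ forall j, `|x.2 0 j - y.2 0 j| < 1].
  apply: filterI; first exact: nilN_nbhs_fst.
  have h : \forall y \near x, ball x.2 (1 : R) y.2.
    by apply: snd_nilN_continuous; exact: nbhsx_ballx.
  by apply: filterS h => y [_ xy] j; exact: xy.
apply/seteqP; split=> [y [[y1 y2] Ly]|_ ->]; last first.
  by split=> //; split=> // j; rewrite subrr normr0.
have : y.2 = x.2; last first.
  by move: y1; case: (x) (y) => [? ?] [? ?] /= -> ->.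
apply/rowP => j; have := y2 j.
have /intrP[a ->] := Lx j; have /intrP[b ->] := Ly j.
rewrite -intrB -intr_norm -[1]/(1%:~R) ltr_int => ab.
by congr intr; lia.
Qed.

Lemma Lambda_nilmanifold : nilmanifold (Lambda R).
Proof.
by split; [exact: nilN_nilpotent|exact: Lambda_discrete|exact: torus_compact].
Qed.

Lemma int_closed : closed [set x : R | x \is a Num.int].
Proof.
rewrite (_ : [set _ | _] = ~` [set x | x \isn't a Num.int]); last first.
  by apply/seteqP; split=> x /=; [move=> -> | move/negP; rewrite negbK].
apply: open_closedC; rewrite openE => x /= xZ; rewrite /interior.
have /andP[h1 h2] := floor_itv x.
have xI : `](Num.floor x)%:~R, (Num.floor x + 1)%:~R[%classic x.
  rewrite /= in_itv/= h2 andbT lt_neqAle h1 andbT.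
  by apply: contraNneq xZ => <-; exact: intr_int.
have nb : nbhs x `](Num.floor x)%:~R, (Num.floor x + 1)%:~R[%classic.
  by apply: open_nbhs_nbhs; split=> //; exact: interval_open.
apply: filterS nb => y /=; rewrite in_itv/= => /andP[y1 y2].
apply/negP => /intrP[k yk]; move: y1 y2; rewrite yk !ltr_int => y1 y2; lia.
Qed.

Lemma proj_subH : coset_proj (Lambda R) @` subH R = torus_proj @` @axis_set R.
Proof.
apply/seteqP; split=> [_ [x [_ x2] <-]|_ [v av <-]].
  by rewrite coset_projE; exists x.2.
by exists (vec v).
Qed.

Lemma proj_normal_closure :
  coset_proj (Lambda R) @` normal_closure (subH R) = [set: W].
Proof.
apply/seteqP; split=> // w _; have [v <-] := torus_proj_surj w.
by exists (vec v) => //; rewrite normal_closure_subH.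
Qed.

(** Pulled back to R^3, the circle becomes the closed set R x Z x Z. *)
Lemma torus_proj_axis_closed : closed (torus_proj @` @axis_set R).
Proof.
apply: torus_proj_preimage_closed.
have -> : torus_proj @^-1` (torus_proj @` @axis_set R) =
    [set v : V | v 0 i1 \is a Num.int] `&` [set v : V | v 0 i2 \is a Num.int].
  apply/seteqP; split=> [v [u [u1 u2] /torus_proj_int uv]|v [/= v1 v2]].
    have := uv i1; have := uv i2; rewrite !mxE u1 u2 !subr0.
    by split.
  exists (row3 (v 0 i0) 0 0); first by split; rewrite row3E.
  apply: torus_proj_eq; apply: ord3_ind; rewrite mxE [X in _ + X]mxE row3E.
  - by rewrite subrr rpred0.
  - by rewrite subr0.
  - by rewrite subr0.
have c j : closed [set v : V | v 0 j \is a Num.int].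
  have := @preimage_closed _ _ (fun v : V => v 0 j)
    [set x | x \is a Num.int] _ int_closed.
  by apply=> v _; exact: coord_continuous.
by apply: closedI; exact: c.
Qed.

Lemma subH_subnilmanifold : subnilmanifold (Lambda R) (subH R).
Proof.
by split; [exact: subH_closed|rewrite proj_subH; exact: torus_proj_axis_closed].
Qed.

Lemma proj_subH_connected : connected (coset_proj (Lambda R) @` subH R).
Proof.
apply: connected_continuous_connected; first exact: subH_connected.
by apply: continuous_subspaceT; exact: pi_continuous.
Qed.

Lemma normal_closure_subnilmanifold :
  subnilmanifold (Lambda R) (normal_closure (subH R)).
Proof.
split; last by rewrite proj_normal_closure; exact: closedT.
have -> : (normal_closure (subH R) : set N) = [set x | x.1 = (0, 0)].
  by rewrite normal_closure_subH; apply/seteqP; split=> x //= [].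
exact: fst_closed.
Qed.

(** * The polynomial sequence g *)

Definition gseq (n : int) : N := ((n, 0), row3 0 0 (n%:~R * Num.sqrt 2)).

Lemma gseq0 : gseq 0 = 1%g.
Proof. by congr pair; apply: row3P; rewrite !(row3E, mxE)// mul0r. Qed.

(** The matrix of g(n) is 1 + n E, without an E^2 term, so t does not reach the third coordinate.
    This is where equidistribution fails. *)
Lemma translation_gseq_axis n t :
  translation (gseq n) (torus_proj (row3 t 0 0)) =
  torus_proj (row3 t (n%:~R * t) (n%:~R * Num.sqrt 2)).
Proof.
rewrite translation_torus_proj; congr torus_proj.
by apply: row3P; rewrite !(row3E, mxE)/= ?row3E; ring.
Qed.

Lemma gseq_dense : dense (\bigcup_(n in [set: int])
  (translation (gseq n) @` (coset_proj (Lambda R) @` subH R))).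
Proof.
move=> O [w Ow] oO; have [v vw] := torus_proj_surj w.
have oV : open (torus_proj @^-1` O).
  by apply: open_comp oO => x _; exact: torus_proj_continuous.
have : nbhs v (torus_proj @^-1` O).
  by apply: open_nbhs_nbhs; split=> //; rewrite /= vw.
move=> /nbhs_ballP[e /= e0 eO].
have [n [t [b [c [tx ty tz]]]]] :=
  sqrt2_line_approx (v 0 i0) (v 0 i1) (v 0 i2) e0.
(* The point of g(n) Y with parameter t, lowered by the integer vector (0, b, c) to bring it near
   v. *)
pose u : V := row3 t (n%:~R * t - b%:~R) (n%:~R * Num.sqrt 2 - c%:~R).
exists (torus_proj u); split.
  apply: eO; split=> // i; rewrite ord1; apply: ord3_ind;
    rewrite row3E /ball/= distrC//.
    by rewrite addrAC.
  by rewrite addrAC.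
exists n => //; exists (torus_proj (row3 t 0 0)).
  by rewrite proj_subH; exists (row3 t 0 0) => //; split; rewrite row3E.
rewrite translation_gseq_axis; apply: torus_proj_eq; apply: ord3_ind;
  rewrite mxE [X in _ + X]mxE !row3E.
- by rewrite subrr rpred0.
- by rewrite addrAC subrr add0r rpredN intr_int.
- by rewrite addrAC subrr add0r rpredN intr_int.
Qed.

(** The binomial coefficient that is the E^2 coefficient of (1 + E)^n. *)
Definition bin2z (n : int) : int := (n * (n - 1) %/ 2)%Z.

Lemma bin2zE n : bin2z n * 2 = n * (n - 1).
Proof.
rewrite /bin2z divzK//; have := divz_eq n 2.
have : 0 <= (n %% 2)%Z by exact: modz_ge0.
have : (n %% 2)%Z < 2 by exact: ltz_pmod.
case: (n %% 2)%Z => [[|[|//]]|//] _ _ ->.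
  by rewrite addr0 dvdz_mulr// dvdz_mull.
by rewrite addrK dvdz_mull// dvdz_mull.
Qed.

(** The cross term m n is the one in [mul2], so n |-> (n, [bin2z n]) is a homomorphism from Z to
    [nilZ2]. *)
Lemma bin2zD m n : bin2z (m + n) = bin2z m + bin2z n + m * n.
Proof.
have := bin2zE m; have := bin2zE n; have := bin2zE (m + n).
move: (bin2z _) (bin2z m) (bin2z n) => x y z hx hy hz; nia.
Qed.

(** A homomorphism from Z is determined by its value at 1; powers are computed below by exhibiting
    such a homomorphism. *)
Lemma expgz_additive (h : int -> N) :
  (forall m n, h (m + n) = (h m * h n)%g) -> forall n, expgz (h 1) n = h n.
Proof.
move=> hD; have h0 : h 0 = 1%g.
  by apply: (@mulgI _ (h 0)); rewrite -hD addr0 mulg1.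
have hn (k : nat) : (h 1%R ^+ k)%g = h k.
  by elim: k => [|k IH]; rewrite ?h0// expgS IH -hD -intS.
case=> k /=; first exact: hn.
rewrite hn; apply: (@mulgI _ (h k.+1)); rewrite mulgV -hD NegzE subrr.
by rewrite h0.
Qed.

Lemma expgz_vec (v : V) n : expgz (vec v) n = vec (v *~ n).
Proof.
rewrite -[v in LHS]/(v *~ 1).
apply: (expgz_additive (h := fun n => vec (v *~ n))) => k l.
by rewrite mulrzDr vecD.
Qed.

Definition gen10 : N := ((1, 0), 0).
Definition gen01 : N := ((0, 1), 0).

Lemma expgz10 n : expgz gen10 n = ((n, bin2z n), 0).
Proof.
apply: (expgz_additive (h := fun n => ((n, bin2z n), 0) : N)) => k l.
rewrite nilN_mulE /nil_mul/= act0 addr0 /mul2/= bin2zD.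
by [].
Qed.

Lemma expgz01 n : expgz gen01 n = ((0, n), 0).
Proof.
apply: (expgz_additive (h := fun n => ((0, n), 0) : N)) => k l.
by rewrite nilN_mulE /nil_mul/= act0 addr0 /mul2/= mul0r !addr0.
Qed.

(** n |-> (n, 0) is not a homomorphism: the powers of [gen10] pick up the E^2 coefficient [bin2z n],
    and the last factor cancels it by a quadratic exponent. *)
Lemma gseqE n : gseq n = (expgz (vec (row3 0 0 (Num.sqrt 2))) n *
  (expgz gen10 n * expgz gen01 (- bin2z n)))%g.
Proof.
rewrite expgz_vec expgz10 expgz01 !nilN_mulE /nil_mul/= !act0 !addr0 /mul2/=.
rewrite !(addr0, add0r, mul0r, mulr0) subrr; congr pair.
by rewrite ?act0 ?addr0; apply: row3P;
  rewrite -(scaler_int n (row3 _ _ _)) [RHS]mxE !row3E ?mulr0.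
Qed.

Lemma gseq_polynomial : polynomial_sequence gseq.
Proof.
exists 3%N, (tnth [tuple vec (row3 0 0 (Num.sqrt 2)); gen10; gen01]).
(* The third exponent is integer-valued although its polynomial has half-integral coefficients. *)
exists (tnth [tuple 'X; 'X; - (2^-1 *: ('X * ('X - 1)))]).
exists (tnth [tuple id; id; fun n => - bin2z n]); split; last first.
  by move=> n; rewrite gseqE !big_ord_recl big_ord0 mulg1.
apply: ord3_ind => n; rewrite ?hornerX// !hornerE /=.
have : (bin2z n)%:~R * 2 = n%:~R * (n%:~R - 1) :> rat.
  by have /(congr1 (fun k : int => k%:~R : rat)) := bin2zE n;
    rewrite !(rmorphM, rmorphB).
by rewrite rmorphN/= => h; lra.
Qed.

(** Vectors come from the identity component, and removing the vector part of g(n) leaves (n, 0).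
    The E^2 direction then appears because n |-> (n, 0) is not a homomorphism. *)
Lemma gseq_generated : generated (identity_component N `|` range gseq) = [set: N].
Proof.
apply/seteqP; split=> // -[[b c] v] _ B [[B1 BV] HB].
have BI x : B x -> B (x^-1)%g.
  by move=> Bx; rewrite -[(x^-1)%g]mul1g; exact: BV.
have BM x y : B x -> B y -> B (x * y)%g.
  by move=> Bx By; rewrite -[y]invgK; apply: (BV) => //; exact: BI.
have BX x n : B x -> B (expgz x n).
  move=> Bx; have Bn (k : nat) : B (x ^+ k)%g.
    by elim: k => // k IH; rewrite expgS; exact: BM.
  by case: n => k //=; apply: BI; exact: Bn.
have Bv u : B (vec u) by apply: HB; left; exact: identity_component_vec.
have Bn n : B ((n, 0), 0).
  have -> : ((n, 0), 0) = (vec (- (gseq n).2) * gseq n)%g.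
    by rewrite nilN_mulE /nil_mul/= act1 addrC subrr mul2_1.
  by apply: (BM) => //; apply: HB; right; exists n.
have Bc n : B ((0, n), 0).
  rewrite -expgz01; apply: (BX).
  (* The square of [gen10] is (2, 1), while g provides (2, 0). *)
  have -> : gen01 = (expgz gen10 2 * ((2, 0%R, 0%R) : N)^-1)%g.
    rewrite expgz10 nilN_mulE nilN_invE /nil_mul/nil_inv/= !act0 oppr0 act0 addr0.
    by congr pair.
  apply: (BV); last exact: Bn.
  by apply: (BX); exact: Bn.
have -> : ((b, c), v) = (vec v * (((b, 0%R), 0%R) : N) * (((0%R, c), 0%R) : N))%g.
  rewrite !nilN_mulE /nil_mul/= !act0 !addr0 /mul2/=.
  by rewrite !(mulr0, mul0r, addr0, add0r).
by apply: (BM) => //; exact: BM.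
Qed.

End torus.

Arguments torus_proj {R} v.

(** * Invariant measures *)

Section invariant_measures.
Local Open Scope ereal_scope.
Variable R : realType.

Definition measure_preserving d (T : measurableType d)
    (mu : {measure set T -> \bar R}) (f : T -> T) :=
  forall A, measurable A -> mu (f @^-1` A) = mu A.

(** The push-forward has the right values on rectangles, and these determine the product measure. *)
Lemma measure_preserving_prod d1 d2 (T1 : measurableType d1)
    (T2 : measurableType d2) (m1 : probability T1 R) (m2 : probability T2 R)
    (f1 : T1 -> T1) (f2 : T2 -> T2) :
  measurable_fun setT f1 -> measurable_fun setT f2 ->
  measure_preserving m1 f1 -> measure_preserving m2 f2 ->
  measure_preserving (m1 \x m2) (fun x => (f1 x.1, f2 x.2)).
Proof.
move=> mf1 mf2 p1 p2 A mA.
have mf : measurable_fun setT (fun x : T1 * T2 => (f1 x.1, f2 x.2)).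
  by apply: measurable_fun_pair; apply: measurableT_comp.
pose mfM := isMeasurableFun.Build _ _ _ _ _ mf.
pose f : {mfun _ >-> _} := HB.pack (fun x : T1 * T2 => (f1 x.1, f2 x.2)) mfM.
have := @product_measure_unique _ _ _ _ _ m1 m2 (distribution (m1 \x m2) f).
move=> U; apply/esym; apply: U => // B C mB mC.
change ((m1 \x m2) ((f1 @^-1` B) `*` (f2 @^-1` C)) = m1 B * m2 C).
by rewrite product_measure1E ?p1 ?p2//
  -[X in measurable X]setTI; [exact: mf1|exact: mf2].
Qed.

(** Lebesgue measure is determined by its values on half-open intervals, whose lengths a shift
    preserves. *)
Lemma lebesgue_measure_translation (s : R) (A : set R) : measurable A ->
  lebesgue_measure ((fun x : R => x + s)%R @^-1` A) = lebesgue_measure A.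
Proof.
move=> mA.
have mf : measurable_fun setT (fun x : R => x + s)%R by exact: measurable_funD.
have mf' : @measurable_fun _ _ (measurableTypeR R) (measurableTypeR R) setT
  (fun x : R => x + s)%R := mf.
pose m : {measure set (measurableTypeR R) -> \bar R} :=
  @pushforward _ _ (measurableTypeR R) (measurableTypeR R) R
    lebesgue_measure (fun x : R => x + s)%R.
apply/esym; apply: (@lebesgue_measure_unique _ (m mf')) => //.
move=> _ [[a b] _ <-].
change (lebesgue_measure `]a, b]%classic =
  lebesgue_measure ((fun x : R => x + s)%R @^-1` `]a, b]%classic)).
have -> : (fun x : R => x + s)%R @^-1` `]a, b]%classic =
    `](a - s)%R, (b - s)%R]%classic.
  by apply/seteqP; split=> x; rewrite /= !in_itv/= ltrBlDr lerBrDr.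
rewrite !lebesgue_measure_itv/= !lte_fin ltrD2r.
by case: ifP => // _; rewrite -!EFinD; congr EFin; ring.
Qed.

Local Notation mR := (measurableTypeR R).

Lemma unit_itv_measurable : measurable (`[0%R, 1%R[%classic : set mR).
Proof. exact: measurable_itv. Qed.

Definition unif : set mR -> \bar R := mrestr lebesgue_measure unit_itv_measurable.
HB.instance Definition _ := Measure.on unif.

Lemma unif_setT : unif setT = 1.
Proof.
by rewrite /unif/mrestr setTI lebesgue_measure_itv/= lte_fin ltr01 oppr0 adde0.
Qed.
HB.instance Definition _ := @Measure_isProbability.Build _ _ R unif unif_setT.

(* Translation by s modulo 1 as a self-map of [0, 1[; outside [0, 1[, a null set
   of unif, it only needs to stay congruent to x + s modulo 1. *)
Definition rot (s x : R) : R :=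
  let r := (s - (Num.floor s)%:~R)%R in
  if (x + r < 1)%R then (x + r)%R else (x + r - 1)%R.

Lemma rot_int s x : (rot s x - (x + s))%R \is a Num.int.
Proof.
rewrite /rot; case: ifP => _.
  rewrite (_ : _ - _ = - (Num.floor s)%:~R)%R; last by ring.
  by rewrite rpredN intr_int.
rewrite (_ : _ - _ = - (Num.floor s)%:~R - 1)%R; last by ring.
by rewrite rpredB ?rpredN ?intr_int ?rpred1.
Qed.

Lemma measurable_rot s : measurable_fun (setT : set mR) (rot s : mR -> mR).
Proof.
change (measurable_fun (setT : set R) (rot s)).
apply: measurable_fun_ifT.
- by apply: measurable_fun_ltr => //; exact: measurable_funD.
- exact: measurable_funD.
- by apply: measurable_funB => //; exact: measurable_funD.
Qed.

(** A rotation exchanges two intervals: with r the fractional part of s, points below 1 - r move by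
    r into [r, 1[ and the others by r - 1 into [0, r[. Each piece is a translation. *)
Lemma rot_preserving s : measure_preserving unif (rot s : mR -> mR).
Proof.
move=> B mB; change (lebesgue_measure (rot s @^-1` B `&` `[0%R, 1%R[%classic) =
  lebesgue_measure (B `&` `[0%R, 1%R[%classic)).
have {}mB : measurable (B : set R) := mB.
have /andP[h1 h2] := floor_itv s; rewrite intrD in h2.
set r := (s - (Num.floor s)%:~R)%R.
have r0 : (0 <= r)%R by rewrite /r; lra.
have r1 : (r < 1)%R by rewrite /r; lra.
have rotE x : rot s x = (if x + r < 1 then x + r else x + (r - 1))%R.
  by rewrite [(x + (r - 1))%R]addrA.
clearbody r.
have m1 : measurable (B `&` `[r, 1%R[%classic) by exact: measurableI.
have m2 : measurable (B `&` `[0%R, r[%classic) by exact: measurableI.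
have tm (t : R) (A : set R) :
    measurable A -> measurable ((fun x : R => x + t)%R @^-1` A).
  by move=> mA; rewrite -[X in measurable X]setTI; exact: measurable_funD.
have -> : rot s @^-1` B `&` `[0%R, 1%R[%classic =
  ((fun x => x + r)%R @^-1` (B `&` `[r, 1%R[%classic)) `|`
  ((fun x => x + (r - 1))%R @^-1` (B `&` `[0%R, r[%classic)).
  apply/seteqP; split=> x /=; rewrite !in_itv/= rotE.
    case: ifPn => [xr|]; last rewrite -leNgt => xr.
      by move=> [Bx /andP[x0 x1]]; left; split=> //; apply/andP; split; lra.
    by move=> [Bx /andP[x0 x1]]; right; split=> //; apply/andP; split; lra.
  case=> [[Bx /andP[x0 x1]]|[Bx /andP[x0 x1]]].
    by rewrite x1; split=> //; apply/andP; split; lra.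
  rewrite ifF; last by apply/negbTE; rewrite -leNgt; lra.
  by split=> //; apply/andP; split; lra.
rewrite measureU//; [|exact: tm|exact: tm|].
  transitivity (lebesgue_measure (B `&` `[r, 1%R[%classic) +
      lebesgue_measure (B `&` `[0%R, r[%classic)).
    by congr (_ + _); exact: lebesgue_measure_translation.
  have -> : B `&` `[0%R, 1%R[%classic =
      (B `&` `[r, 1%R[%classic) `|` (B `&` `[0%R, r[%classic).
    apply/seteqP; split=> x /=; rewrite !in_itv/=.
      move=> [Bx /andP[x0 x1]]; have [xr|xr] := leP r x; [left|right];
        by split=> //; apply/andP.
    by case=> -[Bx /andP[x0 x1]]; split=> //; apply/andP; split; lra.
  rewrite measureU//; apply/seteqP; split=> x //=; rewrite !in_itv/=.
  by move=> [[_ /andP[x0 x1]] [_ /andP[x2 x3]]]; exfalso; lra.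
apply/seteqP; split=> x //=; rewrite !in_itv/=.
by move=> [[_ /andP[x0 x1]] [_ /andP[x2 x3]]]; exfalso; lra.
Qed.

(** The change of variables along [t] turns the integral into its negative, and boundedness makes
    [h] integrable for the finite measure, so the integral is a real number equal to its own
    negative. *)
Lemma integral_odd_preserving d (T : measurableType d) (mu : probability T R)
    (t : {mfun T >-> T}) (h : T -> R) :
  measure_preserving mu t -> measurable_fun setT h ->
  (exists M : R, forall x, `|h x| <= M)%R -> (forall x, h (t x) = - h x)%R ->
  \int[mu]_x (h x)%:E = 0.
Proof.
move=> tP mh [M hM] hN.
have mhE : measurable_fun setT (EFin \o h) by exact/measurable_EFinP.
have hI : mu.-integrable setT (EFin \o h).
  apply: (@le_integrable _ _ _ mu _ measurableT _ (EFin \o cst M)) => //.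
    by move=> x _ /=; rewrite lee_fin (le_trans (hM x))// ler_norm.
  exact: finite_measure_integrable_cst.
have hI' : mu.-integrable setT (EFin \o h \o t).
  rewrite (_ : _ \o _ = (fun x => - (h x)%:E)).
    exact: integrableN.
  by apply/funext => x /=; rewrite hN.
have : \int[mu]_x (h x)%:E = - \int[mu]_x (h x)%:E.
  rewrite -[RHS]integralN; last exact: integrable_add_def.
  transitivity (\int[distribution mu t]_x (h x)%:E).
    by apply: eq_measure_integral => A mA _; rewrite -[LHS]tP.
  rewrite integral_pushforward//.
  by rewrite preimage_setT; apply: eq_integral => x _ /=; rewrite hN.
have : \int[mu]_x (h x)%:E \is a fin_num by exact: integrable_fin_num.
by case: (\int[mu]_x (h x)%:E) => // r _ [] rr; congr EFin; lra.
Qed.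

End invariant_measures.

(** * Haar measures and the test function *)

Section haar.
Variable R : realType.
Local Notation N := (nilN R).
Local Notation V := 'rV[R]_3.
Local Notation W := (coset_space (Lambda R)).
Local Notation bW := (borel W).
Local Notation mR := (measurableTypeR R).
Local Notation mR3 := (mR * (mR * mR))%type.

(** An open subset of R^3 is the union of the countably many rational boxes that it contains, so
    testing on boxes suffices. *)
Lemma torus_proj_measurable d (T : measurableType d) (h : T -> V) :
  (forall s, measurable (h @^-1` @rational_box R 3 s)) ->
  measurable_fun setT (fun x => torus_proj (h x) : bW).
Proof.
move=> mh; apply: (@measurability _ _ T bW _ _ (@open W) erefl).
move=> _ [B oB <-]; rewrite setTI.
have oU : open (torus_proj @^-1` B).
  by apply: open_comp oB => x _; exact: torus_proj_continuous.
have -> : (fun x => torus_proj (h x) : bW) @^-1` B = \bigcup_s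
    (if `[< @rational_box R 3 s `<=` torus_proj @^-1` B >]
     then h @^-1` @rational_box R 3 s else set0).
  apply/seteqP; split=> [x Bx|x [s _]]; last first.
    by case: asboolP => // sB /sB.
  have : nbhs (h x) (torus_proj @^-1` B) by apply: open_nbhs_nbhs; split.
  move=> /rational_box_nbhs[s [sx sB]]; exists s => //.
  by case: asboolP.
apply: countable_bigcupT_measurable => [|s]; first exact: countableP.
by case: ifP.
Qed.

Definition circle_map (t : mR) : bW := torus_proj (row3 (t : R) 0 0).
Definition torus_map (x : mR3) : bW :=
  torus_proj (row3 (x.1 : R) (x.2.1 : R) (x.2.2 : R)).

Lemma measurable_circle_map : measurable_fun setT circle_map.
Proof.
apply: (@torus_proj_measurable _ mR (fun t => row3 (t : R) 0 0)) => s.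
have o : open ((fun t : R => row3 t 0 0) @^-1` rational_box s); last first.
  exact: (open_measurable o).
apply: open_comp (@rational_box_open R 3 s) => x _.
by apply: row3_continuous => ?; [exact: cvg_id|exact: cvg_cst|exact: cvg_cst].
Qed.

Lemma measurable_torus_map : measurable_fun setT torus_map.
Proof.
apply: (@torus_proj_measurable _ mR3
  (fun x => row3 (x.1 : R) (x.2.1 : R) (x.2.2 : R))) => s.
pose I j : set mR := `]ratr (s j).1, ratr (s j).2[%classic.
have -> : (fun x : mR3 => row3 (x.1 : R) (x.2.1 : R) (x.2.2 : R)) @^-1`
    rational_box s = I i0 `*` (I i1 `*` I i2).
  apply/seteqP; split=> [x xs|x [x0 [x1 x2]]]; last first.
    by apply: ord3_ind; rewrite row3E.
  by have := xs i0; have := xs i1; have := xs i2; rewrite !row3E.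
have mI j : measurable (I j) by exact: (@measurable_itv R).
by apply: measurableX => //; exact: measurableX.
Qed.

HB.instance Definition _ := isMeasurableFun.Build _ _ _ _ circle_map
  measurable_circle_map.
HB.instance Definition _ := isMeasurableFun.Build _ _ _ _ torus_map
  measurable_torus_map.

Definition unif3 : probability mR3 R := (@unif R \x (@unif R \x @unif R))%E.

Definition muY : probability bW R := distribution (@unif R) circle_map.
Definition muZ : probability bW R := distribution unif3 torus_map.

Lemma open_borel (A : set W) : open A -> measurable (A : set bW).
Proof. by move=> oA; apply: sub_sigma_algebra. Qed.

Lemma closed_borel (A : set W) : closed A -> measurable (A : set bW).
Proof.
move=> /closed_openC oA; rewrite -[A]setCK; apply: measurableC.
exact: open_borel.
Qed.

(** Modulo Z^3, translation by an element of H rotates the parameter of the circle: [circle_map]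
    intertwines it with [rot], which preserves [unif]. *)
Lemma muY_haar : haar_measure (subH R) muY.
Proof.
split.
  rewrite -[RHS](@probability_setT _ _ _ (@unif R)).
  change (unif (circle_map @^-1` (coset_proj (Lambda R) @` subH R)) = unif setT).
  congr unif; apply/seteqP; split=> // t _; rewrite proj_subH.
  by exists (row3 t 0 0) => //; split; rewrite row3E.
move=> [m v] A [/= -> [v1 v2]] mA.
change (unif (circle_map @^-1` (translation (vec v) @^-1` A)) =
        unif (circle_map @^-1` A)).
have mcA : measurable (circle_map @^-1` A).
  by rewrite -[X in measurable X]setTI; exact: measurable_circle_map.
rewrite -(rot_preserving (v 0 i0) mcA); congr unif.
have E t : translation (vec v) (circle_map t) = circle_map (rot (v 0 i0) t).
  rewrite /circle_map translation_torus_proj; apply: torus_proj_eq; apply: ord3_ind;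
    rewrite mxE [X in _ + X]mxE [X in _ - X]mxE !row3E /= ?v1 ?v2.
  - by rewrite (addrC (v 0 i0)) rot_int.
  - by rewrite mul0r !addr0 subrr rpred0.
  - by rewrite !mul0r !addr0 subrr rpred0.
by apply/seteqP; split=> t /=; rewrite E.
Qed.

(** Translation by a vector becomes a product of three rotations, one in each coordinate. *)
Lemma muZ_haar : haar_measure (normal_closure (subH R)) muZ.
Proof.
split; first by rewrite proj_normal_closure probability_setT.
move=> k A; rewrite normal_closure_subH; case: k => m v [/= -> _] mA.
change (unif3 (torus_map @^-1` (translation (vec v) @^-1` A)) =
        unif3 (torus_map @^-1` A)).
have mcA : measurable (torus_map @^-1` A).
  by rewrite -[X in measurable X]setTI; exact: measurable_torus_map.
have mr s : measurable_fun setT (rot s : mR -> mR) := measurable_rot s.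
have mr2 s t : measurable_fun setT
    ((fun x => (rot s x.1, rot t x.2)) : mR * mR -> mR * mR).
  by apply: measurable_fun_pair; apply: measurableT_comp.
have P2 := measure_preserving_prod (mr (v 0 i1)) (mr (v 0 i2))
  (rot_preserving (v 0 i1)) (rot_preserving (v 0 i2)).
have P3 := measure_preserving_prod (mr (v 0 i0)) (mr2 (v 0 i1) (v 0 i2))
  (rot_preserving (v 0 i0)) P2.
have E x : translation (vec v) (torus_map x) = torus_map
    (rot (v 0 i0) x.1, (rot (v 0 i1) x.2.1, rot (v 0 i2) x.2.2)).
  rewrite /torus_map translation_torus_proj; apply: torus_proj_eq; apply: ord3_ind;
    rewrite mxE [X in _ + X]mxE [X in _ - X]mxE !row3E /= ?mul0r ?addr0.
  - by rewrite (addrC (v 0 i0)) rot_int.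
  - by rewrite (addrC (v 0 i1)) rot_int.
  - by rewrite (addrC (v 0 i2)) rot_int.
have -> : torus_map @^-1` (translation (vec v) @^-1` A) =
    (fun x : mR3 => (rot (v 0 i0) x.1, (rot (v 0 i1) x.2.1, rot (v 0 i2) x.2.2)))
      @^-1` (torus_map @^-1` A) by apply/seteqP; split=> t /=; rewrite E.
exact: (P3 _ mcA).
Qed.

(** * The test function cos (2 pi z) and its integrals *)

Definition height_cos (v : V) : R := cos (v 0 i2 * (pi *+ 2)).

Lemma cosD_int (x : R) (k : int) : cos (x + k%:~R * (pi *+ 2)) = cos x.
Proof.
have cn (n : nat) y : cos (y + n%:R * (pi *+ 2)) = cos y :> R.
  by rewrite mulr_natl (periodicn (@cosD2pi R)).
case: k => n; first exact: cn.
by rewrite NegzE mulrNz mulNr -(cn n.+1) subrK.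
Qed.

Lemma height_cos_int u v : int_set (v - u) -> height_cos u = height_cos v.
Proof.
move=> /(_ i2) /intrP[k]; rewrite !mxE => uv.
by rewrite /height_cos -[v 0 i2](subrK (u 0 i2)) uv addrC mulrDl cosD_int.
Qed.

(** The value is read off a chosen representative; periodicity of the cosine makes the choice
    immaterial. *)
Definition torus_cos (w : W) : R := height_cos (repr w).2.

Lemma torus_cos_proj v : torus_cos (torus_proj v) = height_cos v.
Proof.
by apply: height_cos_int; apply: torus_proj_int;
  rewrite -coset_projE /coset_proj reprK.
Qed.

Lemma torus_cos_continuous : continuous torus_cos.
Proof.
apply/quotient_continuous.
change (continuous (torus_cos \o coset_proj (Lambda R))).
have -> : torus_cos \o coset_proj (Lambda R) = height_cos \o snd.
  by apply/funext => x /=; rewrite coset_projE torus_cos_proj.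
move=> x; apply: continuous_comp; first exact: snd_nilN_continuous.
apply: continuous_comp; last exact: continuous_cos.
have c : {for x.2, continuous (fun v : V => v 0 i2)} by exact: coord_continuous.
exact: (cvgMr_tmp c).
Qed.

Lemma measurable_torus_cos : measurable_fun [set: bW] (torus_cos : bW -> R).
Proof.
apply: (measurability _ (@measurable_realfun.RGenOpens.measurableE R)).
move=> _ [_ [a [b ->] <-]]; rewrite setTI; apply: open_borel.
apply: open_comp; first by move=> x _; exact: torus_cos_continuous.
exact: interval_open.
Qed.

Lemma torus_cos_half (w : W) :
  torus_cos (translation (vec (row3 0 0 (1 / 2))) w) = - torus_cos w.
Proof.
have [v <-] := torus_proj_surj w; rewrite translation_torus_proj.
rewrite !torus_cos_proj /height_cos mxE row3E /= act1.
rewrite mulrDl (_ : 1 / 2 * _ = pi); last by rewrite -mulr_natl; field.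
by rewrite addrC cosDpi.
Qed.

(* Translation by the central element (0, 0, 1/2) of K changes the sign of the
   integrand. *)
Lemma integral_muZ (g : N) :
  (\int[distribution muZ (translation g)]_w (torus_cos w)%:E = 0)%E.
Proof.
pose c := vec (row3 0 0 (1 / 2) : V).
apply: (@integral_odd_preserving R _ _ _ (translation c : bW -> bW)).
- move=> A mA.
  change (muZ (translation g @^-1` (translation c @^-1` A)) =
          muZ (translation g @^-1` A)).
  have mgA : measurable (translation g @^-1` A : set bW).
    by rewrite -[X in measurable X]setTI; exact: translation_measurable.
  have Kc : subgroup_set (normal_closure (subH R)) c by rewrite normal_closure_subH.
  have E (w : W) : translation c (translation g w) = translation g (translation c w).
    have [v <-] := torus_proj_surj w.
    rewrite !translation_torus_proj; congr torus_proj.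
    by apply: row3P; rewrite !(row3E, mxE)/= ?row3E; ring.
  have -> : translation g @^-1` (translation c @^-1` A) =
      translation c @^-1` (translation g @^-1` A).
    by apply/seteqP; split=> w /=; rewrite E.
  by have [_ inv] := muZ_haar; exact: inv.
- exact: measurable_torus_cos.
- by exists 1 => w; rewrite /torus_cos /height_cos ler_norml cos_geN1 cos_le1.
- exact: torus_cos_half.
Qed.

Definition torus_cosC (w : W) : R[i]^o := (torus_cos w)%:C%C.

Lemma real_complex_continuous : continuous (fun x : R => x%:C%C : R[i]^o).
Proof.
move=> x; apply/cvgrPdist_lt => e e0.
(* In the order of R[i] a positive element has zero imaginary part, so [e] is real. *)
have [er ee] : exists er : R, e = er%:C%C.
  exists (complex.Re e); move: e0; rewrite ltcE /= => /andP[/eqP].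
  by case: e => a b /= ->.
rewrite ee ltcR in e0; have /cvgrPdist_lt/(_ er e0) := @cvg_id _ (nbhs x).
apply: filterS => y; rewrite -rmorphB /= normc_def /= expr0n addr0 sqrtr_sqr.
by rewrite ee ltcR.
Qed.

Lemma torus_cosC_continuous : continuous torus_cosC.
Proof.
move=> w; apply: (@continuous_comp _ _ _ torus_cos).
  exact: torus_cos_continuous.
exact: real_complex_continuous.
Qed.

Lemma translate_integral_muZ (g : N) :
  translate_integral muZ g
    (coset_proj (Lambda R) @` normal_closure (subH R)) torus_cosC = 0.
Proof.
rewrite /translate_integral proj_normal_closure.
have -> : translation g @` [set: W] = setT.
  apply/seteqP; split=> // w _; have [v <-] := torus_proj_surj w.
  exists (torus_proj (act (inv2 g.1) (v - g.2))) => //.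
  by rewrite translation_torus_proj -actM mul2Vr act1 addrC subrK.
rewrite /complex_integral /torus_cosC /= /Rintegral integral_muZ /=.
by rewrite integral0.
Qed.

(** All of g(n) Y lies at height n sqrt 2 modulo 1, so the integrand is constant there, and g(n) Y
    has full mass for the push-forward. *)
Lemma translate_integral_muY (n : int) :
  translate_integral muY (gseq R n) (coset_proj (Lambda R) @` subH R) torus_cosC =
  (cos (n%:~R * Num.sqrt 2 * (pi *+ 2)))%:C%C.
Proof.
rewrite /translate_integral proj_subH /complex_integral /torus_cosC /= /Rintegral.
set D := translation _ @` _; set P := distribution _ _.
have DE w : D w -> torus_cos w = cos (n%:~R * Num.sqrt 2 * (pi *+ 2)).
  move=> [_ [v [v1 v2] <-] <-].
  have -> : v = row3 (v 0 i0) 0 0 by apply: row3P; rewrite row3E.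
  by rewrite translation_gseq_axis torus_cos_proj /height_cos row3E.
have mD : measurable (D : set bW).
  apply: closed_borel; apply: torus_proj_preimage_closed.
  (* The affine map undoing g(n) pulls the closed preimage of Y back to that of D, so D is closed
     and hence Borel. *)
  have -> : torus_proj @^-1` D =
      (fun v => act (inv2 (n, 0)) (v - (gseq R n).2)) @^-1`
      (torus_proj @^-1` (torus_proj @` @axis_set R)).
    apply/seteqP; split=> [v [_ [u au <-]]|v /= [u au E]].
      rewrite translation_torus_proj => /torus_proj_int E; exists u => //.
      apply: torus_proj_eq; have := act_int (inv2 (n, 0)) E.
      rewrite -{2}[u](act1 u) -(mul2V (n, 0)) actM -actN -actD.
      by rewrite opprD addrA.
    exists (torus_proj u); first by exists u.
    by rewrite E translation_torus_proj -actM mul2Vr act1 addrC subrK.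
  have ct : closed (torus_proj @^-1` (torus_proj @` @axis_set R)).
    apply: preimage_closed; last exact: torus_proj_axis_closed.
    by move=> x _; exact: torus_proj_continuous.
  apply: preimage_closed ct => x _.
  apply: (@continuous_comp _ _ _ (fun v : V => v - (gseq R n).2));
    last exact: act_continuous.
  exact: (cvgB (@cvg_id _ (nbhs x)) (@cvg_cst _ _ _ _ _)).
(* Y has [muY]-mass 1 and is contained in the preimage of D under translation by g(n). *)
have PD : P D = 1%E.
  apply/eqP; rewrite eq_le probability_le1//=.
  have <- : muY (coset_proj (Lambda R) @` subH R) = 1%E by case: muY_haar.
  rewrite proj_subH.
  change (muY (torus_proj @` @axis_set R) <= muY (translation (gseq R n) @^-1` D))%E.
  apply: le_measure; rewrite ?inE.
  - by apply: closed_borel; exact: torus_proj_axis_closed.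
  - by rewrite -[X in measurable X]setTI; exact: translation_measurable.
  - by move=> w wa; exists w.
rewrite (eq_integral (fun=> (cos (n%:~R * Num.sqrt 2 * (pi *+ 2)))%:E)); last first.
  by move=> w; rewrite inE => /DE ->.
by rewrite integral_cst// [X in (_ * X)%E]PD mule1 integral0.
Qed.

Lemma cos_sqrt2_not_cvg0 :
  ~ ((fun n : nat => cos (n%:R * Num.sqrt 2 * (pi *+ 2)) : R) @ \oo --> (0 : R)).
Proof.
(* If c_n -> 0 then c_2n = 2 c_n^2 - 1 -> -1. *)
move=> /cvgrPdist_lt /(_ (1 / 2)) /(_ ltac:(lra)) [n _ nP].
have := nP n (leqnn n); have := nP (n * 2)%N (leq_pmulr _ _).
rewrite /= !sub0r !normrN natrM.
rewrite (_ : n%:R * 2 * _ * _ = (n%:R * Num.sqrt 2 * (pi *+ 2)) *+ 2); last first.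
  by rewrite -[RHS]mulr_natl; ring.
rewrite cos_mulr2n => /(_ isT); rewrite !ltr_norml.
set c := cos _; rewrite -mulr_natl => /andP[h1 h2] /andP[h3 h4]; nra.
Qed.

End haar.

(** * The nilmanifold, the sequence and the test function put together *)

Theorem theoremA2 (R : realType) :
  exists (N : lieGroupType R) (Lambda H : subgroup N) (g : int -> N),
    let W := coset_space Lambda in
    let Y : set W := coset_proj Lambda @` H in
    let K := normal_closure H in
    let Z : set W := coset_proj Lambda @` K in
    [/\ nilmanifold Lambda & connected [set: W]] /\
    [/\ connected (H : set N), subnilmanifold Lambda H & connected Y] /\
    [/\ polynomial_sequence g, g 0 = 1%g,
        dense (\bigcup_(n in [set: int]) (translation (g n) @` Y)) &
        generated (identity_component N `|` range g) = [set: N]] /\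
    subnilmanifold Lambda K /\
    exists muY muZ : probability (borel W) R,
      haar_measure H muY /\ haar_measure K muZ /\
      exists f : W -> R[i]^o,
        continuous f /\
        ~ ((fun n : nat =>
              (translate_integral muY (g n%:Z) Y f
               - translate_integral muZ (g n%:Z) Z f : R[i]^o))
             @ \oo --> (0 : R[i]^o)).
Proof.
exists (nilN R), (Lambda R), (subH R), (@gseq R).
split; first by split; [exact: Lambda_nilmanifold|exact: torus_connected].
split.
  split; [exact: subH_connected|exact: subH_subnilmanifold|].
  exact: proj_subH_connected.
split.
  split; [exact: gseq_polynomial|exact: gseq0|exact: gseq_dense|].
  exact: gseq_generated.
split; first exact: normal_closure_subnilmanifold.
exists (muY R), (muZ R); split; first exact: muY_haar.
split; first exact: muZ_haar.
exists (@torus_cosC R); split; first exact: torus_cosC_continuous.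
(* The integral over g(n) Z vanishes, so the difference is cos (2 pi n sqrt 2) for every n. *)
have -> : (fun n : nat =>
    (translate_integral (muY R) (gseq R n%:Z) (coset_proj (Lambda R) @` subH R) (@torus_cosC R)
     - translate_integral (muZ R) (gseq R n%:Z)
         (coset_proj (Lambda R) @` normal_closure (subH R)) (@torus_cosC R) : R[i]^o)) =
  (fun n : nat => (cos (n%:R * Num.sqrt 2 * (pi *+ 2)))%:C%C : R[i]^o).
  by apply/funext => n; rewrite translate_integral_muY translate_integral_muZ subr0.
move=> cv; apply: (@cos_sqrt2_not_cvg0 R).
(* Convergence in R[i] is tested at real radii, where the modulus of a real number is its absolute
   value; this yields convergence in R. *)
apply/cvgrPdist_lt => e e0.
have : 0 < e%:C%C :> R[i] by rewrite ltcR.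
have /cvgrPdist_lt/[apply] := cv.
apply: filterS => n; rewrite !sub0r !normrN normc_def /= expr0n addr0 sqrtr_sqr.
by rewrite ltcR.
Qed.
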